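(* Let $\geq$ be the relation on the set of acts $X^S$ defined by $f\geq g\Leftrightarrow N([f\geq g])\geq N([g\geq f])$, where $N$ is a necessity function on $2^S$. Then: (1) $\geq$ is complete: $f\geq g$ or $g\geq f$ for all acts $f,g$; (2) the indifference relation $\sim$ is reflexive and symmetric; (3) the strict relation $>$ on $X^S$ is a transitive, irreflexive partial order; (4) for all acts $f,g,h$: $f>g$ and $g\sim h$ imply $f\geq h$.
   Context: $S$ is a finite set of states; $X$ is a set of consequences with a total preorder $\geq_P$ (complete, transitive) having at least two elements $x,y$ with $x>_P y$. An act is a map $f:S\to X$. For acts $f,g$: $[f\geq g]=\{s\in S:f(s)\geq_P g(s)\}$. A necessity function is a map $N:2^S\to[0,1]$ with $N(F\cap G)=\min(N(F),N(G))$ for all $F,G\subseteq S$ and $N(S)>N(\emptyset)$. For the relation $\geq$ on acts: $f\sim g$ iff $f\geq g$ and $g\geq f$; $f>g$ iff $f\geq g$ and not $g\geq f$. *)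

(* Defs.v *)
From mathcomp Require Import all_boot all_order all_algebra.
From mathcomp Require Import reals.

Set Implicit Arguments.
Unset Strict Implicit.
Unset Printing Implicit Defensive.

Import Order.TTheory GRing.Theory Num.Theory.

Local Open Scope ring_scope.

Definition strict_part (T : Type) (ge : rel T) : rel T :=
  fun x y => ge x y && ~~ ge y x.

Definition indiff_part (T : Type) (ge : rel T) : rel T :=
  fun x y => ge x y && ge y x.

(* N need not be normalized: only N set0 < N setT is required, not
   N set0 = 0 and N setT = 1. *)
Definition necessity (R : realType) (S : finType) (N : {set S} -> R) : Prop :=
  [/\ forall F : {set S}, 0 <= N F <= 1,
      forall F G : {set S}, N (F :&: G) = Num.min (N F) (N G)
    & N set0 < N [set: S]].

Definition ge_event (S : finType) (X : Type) (geP : rel X) (f g : S -> X)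
  : {set S} := [set s | geP (f s) (g s)].

Definition act_ge (R : realType) (S : finType) (X : Type) (geP : rel X)
    (N : {set S} -> R) : rel (S -> X) :=
  fun f g => N (ge_event geP f g) >= N (ge_event geP g f).

(* Main.v *)
(** A necessity function is monotone, so transitivity of the preference on
    consequences gives N [f >= h] >= min (N [f >= g]) (N [g >= h]) for any three
    acts. Applied along the cycles f, g, h and h, f, g and g, h, f, this forces
    transitivity of the strict preference. Part (4) is transitivity together
    with completeness. *)

Require Import Defs.
From mathcomp Require Import all_boot all_order all_algebra.
From mathcomp Require Import reals.

Set Implicit Arguments.
Unset Strict Implicit.
Unset Printing Implicit Defensive.

Import Order.TTheory GRing.Theory Num.Theory.

Local Open Scope ring_scope.

Lemma necessity_le (R : realType) (S : finType) (N : {set S} -> R) :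
  necessity N -> forall F G : {set S}, F \subset G -> N F <= N G.
Proof.
case=> _ NI _ F G /setIidPl FG.
by rewrite -FG NI ge_min lexx orbT.
Qed.

Lemma necessity_ge_event_trans (R : realType) (S : finType) (X : Type)
    (geP : rel X) (N : {set S} -> R) (f g h : S -> X) :
  transitive geP -> necessity N ->
  Num.min (N (ge_event geP f g)) (N (ge_event geP g h))
    <= N (ge_event geP f h).
Proof.
move=> geP_trans N_nec; have [_ NI _] := N_nec.
rewrite -NI; apply: necessity_le => //.
by apply/subsetP=> s; rewrite !inE => /andP[]; apply: geP_trans.
Qed.

Lemma act_ge_total (R : realType) (S : finType) (X : Type) (geP : rel X)
    (N : {set S} -> R) : total (act_ge geP N).
Proof. by move=> f g; apply: le_total. Qed.

(** [act_ge] itself need not be transitive: when [N] is 1 on the full set and 0 elsewhere, pointwise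
    incomparable acts are indifferent. So the strict relation needs its own argument. *)
Lemma strict_act_ge_trans (R : realType) (S : finType) (X : Type)
    (geP : rel X) (N : {set S} -> R) :
  transitive geP -> necessity N -> transitive (strict_part (act_ge geP N)).
Proof.
have strictE f g : strict_part (act_ge geP N) f g
    = (N (ge_event geP g f) < N (ge_event geP f g)).
  by rewrite /strict_part /act_ge -ltNge andb_idl // => /ltW.
move=> geP_trans N_nec g f h; rewrite !strictE => fg gh.
have le3 u v w := necessity_ge_event_trans u v w geP_trans N_nec.
have := le3 f g h; have := le3 h f g; have := le3 g h f.
(* Each cyclic bound on a minimum becomes a disjunction; [hf] is the negated conclusion [N [f >= h]
   <= N [h >= f]]. *)
rewrite ltNge !ge_min => ghf hfg fgh; apply/negP => hf.
have {}ghf : N (ge_event geP h f) <= N (ge_event geP g f).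
  case/orP: ghf => // ghf.
  (* The second alternative closes a strict cycle: [N [g >= h] <= N [g >= f] < N [f >= g] <= N
     [h >= g] < N [g >= h]]. *)
  case/orP: hfg => hfg; last first.
    by have := lt_trans (le_lt_trans ghf fg) (le_lt_trans hfg gh); rewrite ltxx.
  by apply: le_trans ghf; apply: le_trans hfg (ltW gh).
have {}hfg : N (ge_event geP h f) <= N (ge_event geP h g).
  case/orP: hfg => // hfg.
  by apply: le_trans hfg; apply: le_trans ghf (ltW fg).
(* By [hf], [N [h >= f]] dominates [N [f >= g]] or [N [g >= h]]; yet it is at most [N [g >= f]] and
   [N [h >= g]], against [fg] or [gh]. *)
case/orP: fgh => fgh; have := le_trans fgh hf.
  by rewrite leNgt (le_lt_trans ghf fg).
by rewrite leNgt (le_lt_trans hfg gh).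
Qed.

Theorem mainTheorem2 (R : realType) (S : finType) (X : Type) (geP : rel X)
    (geP_total : total geP) (geP_trans : transitive geP)
    (geP_nontriv : exists x y : X, strict_part geP x y)
    (N : {set S} -> R) (N_nec : necessity N) :
  [/\ total (act_ge geP N),
      reflexive (indiff_part (act_ge geP N))
        /\ symmetric (indiff_part (act_ge geP N)),
      [/\ irreflexive (strict_part (act_ge geP N)),
          transitive (strict_part (act_ge geP N))
        & forall f g : S -> X, strict_part (act_ge geP N) f g ->
            ~~ strict_part (act_ge geP N) g f]
    & forall f g h : S -> X, strict_part (act_ge geP N) f g ->
        indiff_part (act_ge geP N) g h -> act_ge geP N f h].
Proof.
have ge_total := @act_ge_total R S X geP N.
have gt_trans := strict_act_ge_trans geP_trans N_nec.
split=> //.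
- split=> [f|f g]; first by rewrite /indiff_part andbb; apply: lexx.
  by rewrite /indiff_part andbC.
- split=> // [f|f g]; first exact: andbN.
  by case/andP=> fg _; rewrite /strict_part fg andbF.
(* If [f >= h] fails, completeness gives [h > f]; with [f > g] this yields [h > g], contradicting
   [g >= h]. *)
move=> f g h fg /andP[gh _]; apply: contraT => not_fh.
have hf : strict_part (act_ge geP N) h f.
  by rewrite /strict_part not_fh andbT; case/orP: (ge_total f h) not_fh => [->|].
by have := gt_trans _ _ _ hf fg; rewrite /strict_part gh andbF.
Qed.
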